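(* Huang and Wong's recurrence for optimal generalized binary split trees (their ''Lemma 4'') and the algorithm based on it are incorrect. Specifically, take the $n=31$ keys, in increasing order, $a1<a2<a3<b0<b4<c0<d0<d1<e0<n0<n1<p0<p2<q0<q1<r0<s0<s1<t0<t2<u0<u1<v0<v3<w0<w1<x0<x2<y0<y1<z0$, with frequencies (weights) $20,20,20,10,20,5,10,22,10,10,20,10,20,10,20,10,10,20,10,20,10,20,10,20,10,20,10,20,10,20,10$ respectively. On this instance the algorithm described below outputs the value $p[0,n,0]=1763$, whereas there exists a generalized binary split tree for this instance of cost $1762$.
   Context: A generalized binary split tree (GBST) for keys $K_1<\dots<K_n$ (only successful queries, i.e., every query is a key) is a rooted binary tree in which each node $N$ has an equality key $e_N$ and a split key $s_N$. A search for $v$ starts at the root; at node $N$, if $v=e_N$ it halts, otherwise it recurses to the left subtree if $v<s_N$ and to the right subtree if $v\ge s_N$. Every key must be found. With key weights $\beta_i$, the cost of the tree is $\sum_i\beta_i\cdot(\text{number of nodes visited by the search for }K_i)$. Huang and Wong's algorithm computes, for $0\le i\le j\le n$ and $0\le d\le j-i$ (''legal'' triples), a triple $(p[i,j,d],w[i,j,d],D[i,j,d])$ with $D[i,j,d]$ a set of key indices, as follows. If $d=j-i$: $(0,0,\{i+1,\dots,j\})$. Otherwise, for each $k\in\{i+1,\dots,j\}$ and $m\in\{0,\dots,d+1\}$ such that $(i,k-1,m)$ and $(k-1,j,d-m+1)$ are legal, form the candidate: $D'=D[i,k-1,m]\cup D[k-1,j,d-m+1]$, $x=$ an index in $D'$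 of minimum $\beta_x$, $w=\beta_x+w[i,k-1,m]+w[k-1,j,d-m+1]$, $c=w+p[i,k-1,m]+p[k-1,j,d-m+1]$, candidate $(c,w,D'\setminus\{x\})$; $(p,w,D)[i,j,d]$ is a minimizing candidate, where candidates are enumerated with $k$ increasing then $m$ increasing, the current choice is replaced only by a later candidate that is lexicographically smaller in $(c,w)$, or equal in $(c,w)$ and whose deleted set is a proper subset of the current one's. The algorithm outputs $p[0,n,0]$ as the optimal cost. *)

(* Defs.v *)
From mathcomp Require Import all_boot.

Set Implicit Arguments.
Unset Strict Implicit.
Unset Printing Implicit Defensive.

(* The keys K_1 < ... < K_n are identified with their ranks: the ordinal
   a : 'I_n stands for K_(a+1), and the order of 'I_n is the order of the keys.
   Weights are natural numbers. *)

(* [Node e s l r] has equality key e and split key s; [Empty] is the empty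
   tree, so a missing child is an [Empty] subtree. *)
Inductive gbst (n : nat) : Type :=
  | Empty
  | Node (e s : 'I_n) (l r : gbst n).

(* Number of nodes visited by the search for v, or None if the search falls
   off the tree without finding v. *)
Fixpoint search (n : nat) (t : gbst n) (v : 'I_n) : option nat :=
  match t with
  | Empty => None
  | Node e s l r =>
      if v == e then Some 1
      else omap S (if v < s then search l v else search r v)
  end.

Definition finds_all (n : nat) (t : gbst n) : Prop :=
  forall v : 'I_n, isSome (search t v).

(* Only meaningful for trees satisfying [finds_all]. *)
Definition cost (n : nat) (beta : 'I_n -> nat) (t : gbst n) : nat :=
  \sum_(v < n) beta v * odflt 0 (search t v).

Definition is_min_cost (n : nat) (beta : 'I_n -> nat) (c : nat) : Prop :=
  (exists t : gbst n, finds_all t /\ cost beta t = c) /\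
  (forall t : gbst n, finds_all t -> c <= cost beta t).

(* The triple (p, w, D) stored for a legal (i, j, d). *)
Record entry (n : nat) : Type :=
  Entry { ep : nat; ew : nat; eD : {set 'I_n} }.

Definition legal (n i j d : nat) : bool := (i <= j <= n) && (d <= j - i).

(* The pairs (k, m) giving a candidate for (i, j, d), with k increasing and then
   m increasing. *)
Definition splits (n i j d : nat) : seq (nat * nat) :=
  [seq km <- [seq (k, m) | k <- iota i.+1 (j - i), m <- iota 0 d.+2]
     | legal n i km.1.-1 km.2 && legal n km.1.-1 j (d.+1 - km.2)].

(* The index x of minimum weight in D' is not made unique: every choice among
   tied indices gives a possible candidate. *)
Definition candidate (n : nat) (beta : 'I_n -> nat)
    (T : nat -> nat -> nat -> entry n) (i j d : nat) (km : nat * nat)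
    (c : entry n) : Prop :=
  let L := T i km.1.-1 km.2 in
  let R := T km.1.-1 j (d.+1 - km.2) in
  let D' := eD L :|: eD R in
  exists2 x : 'I_n,
    x \in D' /\ (forall y : 'I_n, y \in D' -> beta x <= beta y) &
    let w := beta x + ew L + ew R in
    c = Entry (w + ep L + ep R) w (D' :\ x).

Definition better (n : nat) (c cur : entry n) : bool :=
  [|| ep c < ep cur,
      (ep c == ep cur) && (ew c < ew cur) |
      [&& ep c == ep cur, ew c == ew cur & eD c \proper eD cur]].

(* None means that no candidate has been seen yet. *)
Definition update (n : nat) (cur : option (entry n)) (c : entry n) :
    option (entry n) :=
  if cur is Some c0 then Some (if better c c0 then c else c0) else Some c.

(* T is a table that a run of Huang and Wong's dynamic program can produce;
   runs differ only in how ties between indices of minimum weight are broken,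
   independently for each candidate [cand km] of each triple.
   As a : 'I_n stands for K_(a+1), the index set {i+1, ..., j} is
   [set a | i <= a < j]. *)
Definition hw_table (n : nat) (beta : 'I_n -> nat)
    (T : nat -> nat -> nat -> entry n) : Prop :=
  forall i j d : nat, legal n i j d ->
    if d == j - i then T i j d = Entry 0 0 [set a : 'I_n | i <= a < j]
    else exists cand : nat * nat -> entry n,
      (forall km, km \in splits n i j d -> candidate beta T i j d km (cand km)) /\
      Some (T i j d) =
        foldl (@update n) None [seq cand km | km <- splits n i j d].

Definition hw_output (n : nat) (beta : 'I_n -> nat) (c : nat) : Prop :=
  exists2 T, hw_table beta T & c = ep (T 0 n 0).

Definition hw_correct : Prop :=
  forall (n : nat) (beta : 'I_n -> nat) (c : nat),
    hw_output beta c -> is_min_cost beta c.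

Definition freqs : seq nat :=
  [:: (* a1 a2 a3 b0 b4 c0 d0 d1 *) 20; 20; 20; 10; 20;  5; 10; 22;
      (* e0 n0 n1 p0 p2 q0 q1 r0 *) 10; 10; 20; 10; 20; 10; 20; 10;
      (* s0 s1 t0 t2 u0 u1 v0 v3 *) 10; 20; 10; 20; 10; 20; 10; 20;
      (* w0 w1 x0 x2 y0 y1 z0    *) 10; 20; 10; 20; 10; 20; 10].

Definition beta31 (a : 'I_31) : nat := nth 0 freqs a.

(* Main.v *)
(** The deleted set D[i,j,d] always has exactly d elements, so the tie-break by
    proper inclusion never fires, and an induction over the triples shows that
    p, w and the multiset of weights of D do not depend on which index of
    minimum weight is deleted.  Hence one deterministic run on triples
    (p, w, sorted weights of D), evaluated by computation, decides the output
    of all runs.  The cheaper tree was found by a search that keeps, for each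
    interval, the best cost for every multiset of deleted weights. *)

Require Import Defs.
From mathcomp Require Import all_boot.
From mathcomp Require Import zify.
From Stdlib Require Import BinNat Nnat.

Set Implicit Arguments.
Unset Strict Implicit.
Unset Printing Implicit Defensive.

(** * Runs of the recurrence: termination order, sizes of the deleted sets, existence *)

Section Runs.
Variables (n : nat) (beta : 'I_n -> nat).
Implicit Types (T : nat -> nat -> nat -> entry n) (i j d : nat).

(* A split recurs on shorter intervals or, when k = i+1, on the same interval
   with a larger d. *)
Definition rank i j d : nat := (j - i) * n.+1 + (n - d).

Lemma splits_legal i j d km : d <= j - i -> km \in splits n i j d ->
  [/\ i < km.1 <= j, legal n i km.1.-1 km.2 & legal n km.1.-1 j (d.+1 - km.2)].
Proof.
move=> ld; rewrite mem_filter => /andP[/andP[l1 l2]] /allpairsP[[k m] /= [ik im e]].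
by move: l1 l2; rewrite e /=; split=> //; rewrite mem_iota in ik; lia.
Qed.

(** Since [n - d <= n], the interval length dominates in [rank]; at equal length a larger [d] has
    smaller rank. *)
Lemma splits_rank i j d km : legal n i j d -> d < j - i ->
    km \in splits n i j d ->
  rank i km.1.-1 km.2 < rank i j d /\
  rank km.1.-1 j (d.+1 - km.2) < rank i j d.
Proof.
move=> lg ld /(splits_legal (ltnW ld)).
case: km => k m /= [kij]; rewrite /rank; move: lg; rewrite /legal => lg l1 l2.
have mm (a b x y : nat) : a < b -> x <= n -> a * n.+1 + x < b * n.+1 + y.
  move=> ab xn; apply: (@leq_trans (a.+1 * n.+1)); first by rewrite mulSn; lia.
  by apply: leq_trans (leq_addr _ _); rewrite leq_mul2r ab orbT.
split; first by apply: mm; lia.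
(* The right interval fails to shrink only for [k = i.+1]; then the left one is empty, which forces
   [m = 0], and [d] grows by one. *)
have [ki|ki] := leqP k i.+1; last by apply: mm; lia.
have -> : k.-1 = i by lia.
have -> : m = 0 by lia.
by rewrite ltn_add2l; lia.
Qed.

Lemma splits_nonempty i j d : legal n i j d -> d < j - i ->
  (i.+1, 0) \in splits n i j d.
Proof.
move=> lg ld; rewrite mem_filter; apply/andP; split.
  by move: lg; rewrite /legal /=; lia.
by apply/allpairsP; exists (i.+1, 0); split; rewrite ?mem_iota //=; lia.
Qed.

Lemma enum_interval i j : j <= n ->
  perm_eq [seq val a | a <- enum [set a : 'I_n | i <= a < j]] (iota i (j - i)).
Proof.
move=> jn; apply: uniq_perm; rewrite ?iota_uniq ?map_inj_uniq ?enum_uniq //.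
  exact: val_inj.
move=> a; rewrite mem_iota; apply/mapP/idP => [[x]|ha].
  by rewrite mem_enum inE => ? -> /=; lia.
have an : a < n by lia.
by exists (Ordinal an); rewrite // mem_enum inE /=; lia.
Qed.

(** The size is the key invariant: equal sizes exclude proper inclusion, and a union of size [d.+1]
    has an element to delete. *)
Definition wf i j d (e : entry n) : Prop :=
  eD e \subset [set a : 'I_n | i <= a < j] /\ #|eD e| = d.

Lemma wf_disjoint i q j d1 d2 e1 e2 :
  wf i q d1 e1 -> wf q j d2 e2 -> [disjoint eD e1 & eD e2].
Proof.
move=> [s1 _] [s2 _]; apply/pred0P => a /=; apply/negP => /andP[a1 a2].
move: (subsetP s1 _ a1) (subsetP s2 _ a2); rewrite !inE; lia.
Qed.

Lemma card_join i q j d1 d2 e1 e2 :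
  wf i q d1 e1 -> wf q j d2 e2 -> #|eD e1 :|: eD e2| = d1 + d2.
Proof.
move=> w1 w2; have := wf_disjoint w1 w2.
(* Equality in the bound on the size of a union characterizes disjointness. *)
by rewrite -(geq_leqif (leq_card_setU _ _)) -w1.2 -w2.2 => h;
   apply/eqP; rewrite eqn_leq h (leq_card_setU _ _).1.
Qed.

Lemma wf_base i j : j <= n ->
  wf i j (j - i) (Entry 0 0 [set a : 'I_n | i <= a < j]).
Proof.
by move=> /(enum_interval i)/perm_size; rewrite size_map size_iota -cardE.
Qed.

Definition wf_splits T i j d : Prop :=
  forall km, km \in splits n i j d ->
    wf i km.1.-1 km.2 (T i km.1.-1 km.2) /\
    wf km.1.-1 j (d.+1 - km.2) (T km.1.-1 j (d.+1 - km.2)).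

Lemma card_split T i j d km : d <= j - i -> km \in splits n i j d ->
    wf_splits T i j d ->
  #|eD (T i km.1.-1 km.2) :|: eD (T km.1.-1 j (d.+1 - km.2))| = d.+1.
Proof.
move=> ld hkm /(_ km hkm)[w1 w2]; rewrite (card_join w1 w2) subnKC //.
by move: hkm; rewrite mem_filter => /andP[_] /allpairsP[[k m] [_]] +->;
   rewrite mem_iota /=; lia.
Qed.

Lemma wf_candidate T i j d km e : d <= j - i -> km \in splits n i j d ->
  wf_splits T i j d -> candidate beta T i j d km e -> wf i j d e.
Proof.
move=> ld hkm hw [x [xD xmin] ->]; split=> /=; last first.
  by have := card_split ld hkm hw; rewrite (cardsD1 x) xD => -[].
have [kij _ _] := splits_legal ld hkm; have [[s1 _] [s2 _]] := hw _ hkm.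
apply: subset_trans (subsetDl _ _) _; apply/subsetP => a; rewrite inE.
by case/orP => [/(subsetP s1)|/(subsetP s2)]; rewrite !inE; lia.
Qed.

(** [update] only ever selects, so the result of the fold is one of the candidates. *)
Lemma foldl_update_ind (P : entry n -> Prop) ks cand e :
    (forall km : nat * nat, km \in ks -> P (cand km)) ->
  Some e = foldl (@update n) None [seq cand km | km <- ks] -> P e.
Proof.
move=> Pc; have : forall e, Some e = None -> P e by [].
elim: ks None Pc => [|km ks IH] o Pc Po /=; first exact: Po.
apply: IH => [k hk|e']; first by apply: Pc; rewrite inE hk orbT.
case: o Po => [e0|] /= Po [->]; last by apply: Pc; rewrite mem_head.
by case: ifP => _; [apply: Pc; rewrite mem_head | apply: Po].
Qed.

(** The clause of [hw_table] at a single triple, so that a table under construction can be treated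
    rank by rank. *)
Definition hw_at T i j d : Prop :=
  if d == j - i then T i j d = Entry 0 0 [set a : 'I_n | i <= a < j]
  else exists cand : nat * nat -> entry n,
    (forall km, km \in splits n i j d -> candidate beta T i j d km (cand km)) /\
    Some (T i j d) = foldl (@update n) None [seq cand km | km <- splits n i j d].

Lemma hw_at_wf T i j d : legal n i j d -> hw_at T i j d ->
  (d < j - i -> wf_splits T i j d) -> wf i j d (T i j d).
Proof.
rewrite /hw_at => /andP[/andP[_ jn] ld]; have [-> ->|nd] := eqVneq d (j - i).
  by move=> _; apply: wf_base.
move=> [cand [hc hT]] /(_ _)/[dup] => hs _; apply: foldl_update_ind hT => km hkm.
by apply: wf_candidate (hc _ hkm) => //; apply: hs; lia.
Qed.

Lemma wf_splits_rank T i j d : legal n i j d -> d < j - i ->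
    (forall i' j' d', rank i' j' d' < rank i j d -> legal n i' j' d' ->
       wf i' j' d' (T i' j' d')) ->
  wf_splits T i j d.
Proof.
move=> lg ld IH km hkm; have [_ l1 l2] := splits_legal (ltnW ld) hkm.
by have [r1 r2] := splits_rank lg ld hkm; split; apply: IH.
Qed.

Lemma hw_wf T : hw_table beta T ->
  forall i j d, legal n i j d -> wf i j d (T i j d).
Proof.
move=> hT i j d; have [r] := ubnP (rank i j d).
elim: r i j d => // r IH i j d hr lg.
apply: hw_at_wf => // [|ld]; first exact: hT.
by apply: wf_splits_rank => // i' j' d' hr'; apply: IH; lia.
Qed.

(** Fixes one tie-breaking choice; the default is never reached when the two entries are well
    formed. *)
Definition candidate_fun T i j d (km : nat * nat) : entry n :=
  let L := T i km.1.-1 km.2 in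
  let R := T km.1.-1 j (d.+1 - km.2) in
  let D' := eD L :|: eD R in
  if [pick x in D' | [forall y in D', beta x <= beta y]] is Some x then
    let w := beta x + ew L + ew R in Entry (w + ep L + ep R) w (D' :\ x)
  else Entry 0 0 set0.

Lemma candidate_funP T i j d km : d <= j - i -> km \in splits n i j d ->
  wf_splits T i j d -> candidate beta T i j d km (candidate_fun T i j d km).
Proof.
move=> ld hkm hw; rewrite /candidate /candidate_fun.
have := card_split ld hkm hw; set D := _ :|: _ => cD.
case: pickP => [x /andP[xD /forall_inP xmin]|no]; first by exists x.
have /card_gt0P[x0 x0D] : 0 < #|D| by rewrite cD.
case: (arg_minnP beta x0D) => x xD xmin.
by have := no x; rewrite [x \in D]xD => /negP[]; apply/forall_inP.
Qed.

Definition step T i j d : entry n :=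
  if d == j - i then Entry 0 0 [set a : 'I_n | i <= a < j]
  else odflt (Entry 0 0 set0)
    (foldl (@update n) None [seq candidate_fun T i j d km | km <- splits n i j d]).

Lemma eq_step T T' i j d : legal n i j d ->
    (forall i' j' d', rank i' j' d' < rank i j d -> legal n i' j' d' ->
       T i' j' d' = T' i' j' d') ->
  step T i j d = step T' i j d.
Proof.
move=> lg IH; rewrite /step; have [//|nd] := eqVneq d (j - i).
have ld : d < j - i by rewrite ltn_neqAle nd; case/andP: lg.
congr (odflt _ (foldl _ _ _)); apply/eq_in_map => km hkm.
have [_ l1 l2] := splits_legal (ltnW ld) hkm.
have [r1 r2] := splits_rank lg ld hkm.
by rewrite /candidate_fun !IH.
Qed.

Lemma step_hw_at T i j d : legal n i j d -> T i j d = step T i j d ->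
  (d < j - i -> wf_splits T i j d) -> hw_at T i j d.
Proof.
rewrite /hw_at /step => lg ->; case: eqVneq => [//|nd] hw.
have ld : d < j - i by rewrite ltn_neqAle nd; case/andP: lg.
exists (candidate_fun T i j d); split.
  by move=> km hkm; apply: candidate_funP hkm (hw ld); apply: ltnW.
have := splits_nonempty lg ld; case: (splits n i j d) => //= km ks _.
by elim: ks (candidate_fun T i j d km) => //= k ks IH e; rewrite -IH.
Qed.

(** Iterating [step] from an arbitrary table fixes the value at a triple once the number of rounds
    exceeds its rank; the table of these stable values is a run. *)
Lemma hw_table_exists : exists T, hw_table beta T.
Proof.
pose It s := iter s step (fun _ _ _ => Entry 0 0 set0).
have stable s s' i j d : rank i j d < s -> rank i j d < s' -> legal n i j d ->
    It s i j d = It s' i j d.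
  elim: s s' i j d => // s IH [//|s'] i j d rs rs' lg; rewrite /It !iterS.
  by apply: eq_step lg _ => i' j' d' r' lg'; apply: IH => //; lia.
pose T i j d := It (rank i j d).+1 i j d.
have TE i j d : legal n i j d -> T i j d = step T i j d.
  by move=> lg; apply: eq_step lg _ => i' j' d' r' lg'; apply: stable.
have wfT i j d : legal n i j d -> wf i j d (T i j d).
  have [r] := ubnP (rank i j d); elim: r i j d => // r IH i j d hr lg.
  have ws : d < j - i -> wf_splits T i j d.
    by move=> ld; apply: wf_splits_rank => // i' j' d' hr'; apply: IH; lia.
  by apply: hw_at_wf => //; apply: step_hw_at => //; apply: TE.
exists T => i j d lg; apply: step_hw_at => // [|ld]; first exact: TE.
by apply: wf_splits_rank => // i' j' d' _; apply: wfT.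
Qed.

End Runs.

(** * An executable version of the recurrence on weight lists *)

(* (p, w) and the sorted weights of D; binary numbers keep evaluation fast. *)
Definition cell : Type := N * N * seq N.
Definition cell0 : cell := (N0, N0, [::]).

(** The head of the merged list, obtained without merging, so that a losing candidate costs no
    merge. *)
Definition min_head (s t : seq N) : N :=
  if s is x :: _ then if t is y :: _ then if N.leb x y then x else y else x
  else head N0 t.

Definition join_cost (LR : cell * cell) : N * N :=
  let: ((pL, wL, sL), (pR, wR, sR)) := LR in
  let w := N.add (N.add (min_head sL sR) wL) wR in
  (N.add (N.add w pL) pR, w).

Definition join_rest (LR : cell * cell) : seq N :=
  behead (merge N.leb LR.1.2 LR.2.2).

Definition cost_lt (a b : N * N) : bool :=
  match N.compare a.1 b.1 with
  | Lt => true
  | Eq => N.ltb a.2 b.2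
  | Gt => false
  end.

Definition cupdate (cur : option cell) (LR : cell * cell) : option cell :=
  let pw := join_cost LR in
  if cur is Some c then
    if cost_lt pw c.1 then Some (pw, join_rest LR) else cur
  else Some (pw, join_rest LR).

(* Tables are indexed by j - i, then i, then d. *)
Definition row (tab : seq (seq (seq cell))) (i j : nat) : seq cell :=
  nth [::] (nth [::] tab (j - i)) i.

(* Computing [splits] by filtering would spend most of its time on illegal pairs. *)
Definition legal_splits (i j d : nat) : seq (nat * nat) :=
  [seq (k, m) | k <- iota i.+1 (j - i),
     m <- iota (d.+1 - (j - k.-1)) ((minn d.+1 (k.-1 - i)).+1 - (d.+1 - (j - k.-1)))].

(* [A q] lists the cells of (i, q, _) and [B q] those of (q, j, _). *)
Definition next_cell (A B : nat -> seq cell) (i j d : nat) : cell :=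
  odflt cell0 (foldl cupdate None
    [seq (nth cell0 (A km.1.-1) km.2, nth cell0 (B km.1.-1) (d.+1 - km.2))
       | km <- legal_splits i j d]).

(* The cells of (i, j, d) for j - i - t <= d <= j - i.  The padding by [ncons]
   puts the cells already computed for (i, j) at the positions d they stand for. *)
Fixpoint row_suffix (b : nat -> N) tab (i j t : nat) : seq cell :=
  if t is t'.+1 then
    let s := row_suffix b tab i j t' in
    let d := j - i - t in
    next_cell (row tab i)
      (* For [k = i.+1] the right part is [(i, j)] itself with [d.+1], the position at which [s]
         begins. *)
      (fun q => if q == i then ncons d.+1 cell0 s else row tab q j) i j d :: s
  else [:: (N0, N0, sort N.leb [seq b a | a <- iota i (j - i)])].

Fixpoint table (b : nat -> N) (n L : nat) : seq (seq (seq cell)) :=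
  if L is L'.+1 then
    let tab := table b n L' in
    rcons tab [seq row_suffix b tab i (i + L') L' | i <- iota 0 (n.+1 - L')]
  else [::].

Definition output (b : nat -> N) (n : nat) : N :=
  (nth cell0 (row (table b n n.+1) 0 n) 0).1.1.

(** * Enumeration of legal splits, and comparison of binary with unary numbers *)

Lemma filter_iota0 s lo hi : hi <= s ->
  [seq m <- iota 0 s | lo <= m < hi] = iota lo (hi - lo).
Proof.
move=> hs; apply: (irr_sorted_eq ltn_trans ltnn).
- by apply: sorted_filter; [exact: ltn_trans | exact: iota_ltn_sorted].
- exact: iota_ltn_sorted.
by move=> m; rewrite mem_filter !mem_iota; lia.
Qed.

(** For fixed [k], legality of both halves confines [m] to an interval: [m <= k.-1 - i] and
    [d.+1 - m <= j - k.-1]. *)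
Lemma splitsE n i j d : legal n i j d -> splits n i j d = legal_splits i j d.
Proof.
rewrite /splits /legal_splits filter_flatten -map_comp /legal => lg; congr flatten.
apply/eq_in_map => k; rewrite mem_iota => hk; rewrite [LHS]filter_map.
congr (map _ _); rewrite -(@filter_iota0 d.+2); last by lia.
by apply: eq_in_filter => m; rewrite mem_iota /=; lia.
Qed.

Lemma N_leb_total : total N.leb.
Proof. by move=> x y; case: N.leb_spec => //= h; apply/N.leb_spec0/N.lt_le_incl. Qed.

Lemma N_leb_trans : transitive N.leb.
Proof.
by move=> y x z /N.leb_spec0 xy /N.leb_spec0 yz; apply/N.leb_spec0/(N.le_trans _ y).
Qed.

Lemma leq_N_to_nat x y : N.leb x y = (N.to_nat x <= N.to_nat y).
Proof. by apply/N.leb_spec0/idP; lia. Qed.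

Lemma cost_ltE a b : cost_lt a b =
  (N.to_nat a.1 < N.to_nat b.1) ||
  (N.to_nat a.1 == N.to_nat b.1) && (N.to_nat a.2 < N.to_nat b.2).
Proof.
rewrite /cost_lt; case: N.compare_spec => h; last 2 first.
- by rewrite [N.to_nat a.1 < _](_ : _ = true) //; lia.
- by case: ltngtP => //; lia.
by rewrite h ltnn eqxx /=; case: N.ltb_spec; lia.
Qed.

Lemma head_merge s t : head N0 (merge N.leb s t) = min_head s t.
Proof. by case: s t => [|x s] [|y t] //=; case: ifP. Qed.

(** * The executable version encodes every run *)

Section Encoding.
Variables (n : nat) (beta : 'I_n -> nat) (b : nat -> N).
Hypothesis beta_b : forall a, beta a = N.to_nat (b a).

Definition weights (D : {set 'I_n}) : seq nat := [seq beta x | x <- enum D].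

(** Only the multiset of weights of the deleted set is recorded, so entries that differ by tied
    indices share a cell. *)
Definition encodes (c : cell) (e : entry n) : Prop :=
  [/\ ep e = N.to_nat c.1.1, ew e = N.to_nat c.1.2, sorted N.leb c.2 &
      perm_eq (weights (eD e)) [seq N.to_nat y | y <- c.2]].

Definition join (LR : cell * cell) : cell := (join_cost LR, join_rest LR).

Lemma weightsU (A B : {set 'I_n}) : [disjoint A & B] ->
  perm_eq (weights (A :|: B)) (weights A ++ weights B).
Proof.
move=> dAB; rewrite -map_cat; apply: perm_map; apply: uniq_perm => [||x].
- exact: enum_uniq.
- rewrite cat_uniq !enum_uniq andbT /=; apply/hasPn => x; rewrite !mem_enum.
  by move=> xB; apply: contraL xB => xA; rewrite (disjointFr dAB).
by rewrite mem_cat !mem_enum inE.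
Qed.

Lemma weightsD1 (A : {set 'I_n}) x : x \in A ->
  perm_eq (weights A) (beta x :: weights (A :\ x)).
Proof.
move=> xA; rewrite -/(map beta (x :: enum (A :\ x))); apply: perm_map.
apply: uniq_perm => [||y]; rewrite /= ?enum_uniq // ?mem_enum ?setD11 //.
by rewrite in_cons !mem_enum !inE; case: eqP => [->|].
Qed.

(** Whichever minimum-weight index is deleted, its weight is the head of the merged list, so the
    remaining weights are the tail. *)
Lemma join_encodes T i j d km e cL cR :
    encodes cL (T i km.1.-1 km.2) -> encodes cR (T km.1.-1 j (d.+1 - km.2)) ->
    [disjoint eD (T i km.1.-1 km.2) & eD (T km.1.-1 j (d.+1 - km.2))] ->
  candidate beta T i j d km e -> encodes (join (cL, cR)) e.
Proof.
case: cL cR => [[pL wL] sL] [[pR wR] sR] [/= pLE wLE sortL permL].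
move=> [/= pRE wRE sortR permR] dLR [x [xD xmin] ->].
set D := _ :|: _ in xD xmin *.
have permD : perm_eq (weights D) [seq N.to_nat y | y <- merge N.leb sL sR].
  apply: perm_trans (weightsU dLR) _; apply: perm_trans (perm_cat permL permR) _.
  by rewrite -map_cat perm_sym perm_map // perm_merge.
have sortD : sorted N.leb (merge N.leb sL sR).
  by apply: merge_sorted => //; apply: N_leb_total.
rewrite /encodes /join /join_rest /= -head_merge.
have xW : beta x \in weights D by rewrite map_f ?mem_enum.
case: (merge N.leb sL sR) sortD permD => [_ /perm_mem/(_ (beta x))|y s sorts permD].
  by rewrite xW.
(* Minimality of [x] gives one inequality, sortedness of the merged list the other. *)
have xy : beta x = N.to_nat y.
  apply/eqP; rewrite eqn_leq; apply/andP; split.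
    have : N.to_nat y \in weights D by rewrite (perm_mem permD) mem_head.
    by case/mapP => z; rewrite mem_enum => zD ->; apply: xmin.
  have : beta x \in [seq N.to_nat z | z <- y :: s] by rewrite -(perm_mem permD).
  case/mapP => z zs ->; rewrite -leq_N_to_nat.
  move: zs; rewrite in_cons => /predU1P[->|]; first by rewrite N.leb_refl.
  by have /allP := order_path_min N_leb_trans sorts; apply.
split; rewrite /= ?pLE ?wLE ?pRE ?wRE ?xy ?N2Nat.inj_add //.
- exact: path_sorted sorts.
rewrite -(perm_cons (beta x)) [in X in perm_eq _ X]xy.
by apply: perm_trans permD; rewrite perm_sym; apply: weightsD1.
Qed.

Definition oencodes d (c : option cell) (e : option (entry n)) : Prop :=
  match c, e with
  | Some c, Some e => encodes c e /\ #|eD e| = d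
  | None, None => True
  | _, _ => False
  end.

(* Deleted sets of the same triple have the same size, so none is a proper
   subset of another. *)
Lemma update_oencodes d c e LR e' : oencodes d c e -> encodes (join LR) e' ->
  #|eD e'| = d -> oencodes d (cupdate c LR) (update e e').
Proof.
case: c e => [c|] [e|] //= [ce ed] ce' e'd; rewrite /cupdate -/(join LR).
have -> : better e' e = cost_lt (join_cost LR) c.1.
  rewrite /better cost_ltE; case: ce ce' => -> -> _ _ [-> -> _ _] /=.
  by rewrite properEcard ed e'd ltnn !andbF orbF.
by case: cost_lt.
Qed.

Lemma foldl_oencodes d ks cand LR c e :
    (forall km : nat * nat, km \in ks ->
       encodes (join (LR km)) (cand km) /\ #|eD (cand km)| = d) ->
    oencodes d c e ->
  oencodes d (foldl cupdate c [seq LR km | km <- ks])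
    (foldl (@update n) e [seq cand km | km <- ks]).
Proof.
elim: ks c e => //= km ks IH c e h ce; apply: IH => [k hk|].
  by apply: h; rewrite in_cons hk orbT.
by have [? ?] := h km (mem_head _ _); apply: update_oencodes.
Qed.

Variable T : nat -> nat -> nat -> entry n.
Hypothesis hT : hw_table beta T.

Definition encodes_row i j d0 (s : seq cell) : Prop :=
  forall d, d0 <= d <= j - i -> encodes (nth cell0 s d) (T i j d).

Lemma next_cell_encodes A B i j d : legal n i j d -> d < j - i ->
    (forall q, i <= q < j -> encodes_row i q 0 (A q)) ->
    (forall q, i <= q < j -> encodes_row q j (if q == i then d.+1 else 0) (B q)) ->
  encodes (next_cell A B i j d) (T i j d).
Proof.
move=> lg ld hA hB; have := hT lg; rewrite ltn_eqF // => -[cand [hc]].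
pose LR (km : nat * nat) :=
  (nth cell0 (A km.1.-1) km.2, nth cell0 (B km.1.-1) (d.+1 - km.2)).
have ws : wf_splits T i j d.
  by apply: wf_splits_rank => // i' j' d' _; apply: (hw_wf hT).
have hLR km : km \in splits n i j d ->
    encodes (join (LR km)) (cand km) /\ #|eD (cand km)| = d.
  case: km => k m hkm; have [/= kij l1 l2] := splits_legal (ltnW ld) hkm.
  have [w1 w2] := ws _ hkm; split; last first.
    by have [] := wf_candidate (ltnW ld) hkm ws (hc _ hkm).
  apply: join_encodes (wf_disjoint w1 w2) (hc _ hkm).
    by apply: hA; move: l1; rewrite /legal /=; lia.
  apply: hB; move: l1 l2; rewrite /legal /=; first by lia.
  by case: ifP => [/eqP|_]; lia.
have := @foldl_oencodes d _ cand LR None None hLR I.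
rewrite /next_cell -(splitsE lg).
(* By [eT] the abstract fold is a [Some], hence so is the encoded one, and [cell0] is not
   returned. *)
by move=> + eT; rewrite -eT; case: foldl => [c []|].
Qed.

(** Induction on decreasing [d]: a new cell needs shorter intervals and, for [k = i.+1], the cell of
    [(i, j, d.+1)] already in the suffix. *)
Lemma row_suffix_encodes tab i j t : i <= j <= n -> t <= j - i ->
    (forall i' j', i' <= j' <= n -> j' - i' < j - i ->
       encodes_row i' j' 0 (row tab i' j')) ->
  encodes_row i j (j - i - t) (ncons (j - i - t) cell0 (row_suffix b tab i j t)).
Proof.
move=> hij + htab; elim: t => [_|t IH ht] d hd.
  have -> : d = j - i by lia.
  rewrite nth_ncons subn0 ltnn subnn /=.
  have -> : T i j (j - i) = Entry 0 0 [set a : 'I_n | i <= a < j].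
    by have := @hT i j (j - i); rewrite eqxx; apply; rewrite /legal; lia.
  split=> //=; first by apply: sort_sorted; apply: N_leb_total.
  have weightsE D :
      weights D = [seq N.to_nat y | y <- [seq b a | a <- [seq val x | x <- enum D]]].
    by rewrite -!map_comp; apply: eq_map => a; apply: beta_b.
  rewrite weightsE; apply: perm_map; rewrite perm_sym perm_sort perm_sym.
  by apply: perm_map; apply: enum_interval; lia.
rewrite nth_ncons ltnNge; have -> /= : j - i - t.+1 <= d by lia.
have [dE|dN] := eqVneq d (j - i - t.+1).
  rewrite -dE subnn /=; apply: next_cell_encodes; rewrite /legal; try lia.
    by move=> q hq; apply: htab; lia.
  move=> q hq /=; case: eqVneq => [->|qi]; last by apply: htab; lia.
  have dE1 : d.+1 = j - i - t by lia.
  by rewrite -[cell0 :: _]/(ncons d.+1 cell0 _) dE1; apply: IH; lia.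
have -> : d - (j - i - t.+1) = (d - (j - i - t)).+1 by lia.
have /= := IH _ d _; rewrite nth_ncons ltnNge; have -> /= : j - i - t <= d by lia.
by apply; lia.
Qed.

Lemma table_encodes L i j : i <= j <= n -> j - i < L ->
  encodes_row i j 0 (row (table b n L) i j).
Proof.
elim: L i j => // L IH i j hij hL.
have size_table L' : size (table b n L') = L'.
  by elim: L' => //= L' IHL; rewrite size_rcons IHL.
rewrite /row /= nth_rcons size_table.
case: ltngtP => [lt|gt|eqL]; [exact: IH | lia |].
rewrite -eqL (nth_map 0) ?size_iota ?nth_iota; try lia.
rewrite add0n; have -> : i + (j - i) = j by lia.
(* At [t = j - i] the suffix reaches [d = 0], so the padding is empty and the suffix is the full
   row. *)
have := @row_suffix_encodes (table b n (j - i)) i j (j - i) hij (leqnn _).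
rewrite subnn /=; apply => i' j' h1 h2; rewrite eqL in h2 *.
exact: IH.
Qed.

Lemma output_encodes : ep (T 0 n 0) = N.to_nat (output b n).
Proof.
have := @table_encodes n.+1 0 n; rewrite subn0 leqnn ltnSn => /(_ isT isT 0 isT).
by case.
Qed.

End Encoding.

(** * The instance with 31 keys *)

Definition key31 (a : nat) : 'I_31 := Ordinal (ltn_pmod a (isT : 0 < 31)).

(** Numerals are ranks counted from 0; the root holds the heaviest key d1 (rank 7) and splits at s0
    (rank 16). *)
Definition better_tree : gbst 31 :=
  let E := Empty 31 in
  let N a b l r := Node (key31 a) (key31 b) l r in
  N 7 16 (N 2 9 (N 1 4 (N 0 0 E (N 3 0 E E)) (N 4 7 (N 6 4 E (N 5 4 E E))
    (N 8 7 E E))) (N 14 12 (N 10 10 (N 9 9 E E) (N 11 10 E E)) (N 12 14 (N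
    13 12 E E) (N 15 14 E E)))) (N 29 23 (N 21 19 (N 17 17 (N 16 16 E E)
    (N 18 17 E E)) (N 19 21 (N 20 19 E E) (N 22 21 E E))) (N 25 27 (N 23
    25 (N 24 23 E E) (N 26 25 E E)) (N 27 29 (N 28 27 E E) (N 30 29 E
    E)))).

Lemma key31K (v : 'I_31) : key31 v = v.
Proof. by apply: val_inj; rewrite /= modn_small. Qed.

Lemma better_tree_finds_all : finds_all better_tree.
Proof.
move=> v; rewrite -(key31K v).
have /allP : all (fun a => isSome (search better_tree (key31 a))) (iota 0 31).
  by vm_compute.
by apply; rewrite mem_iota ltn_ord.
Qed.

Lemma better_tree_cost : cost beta31 better_tree = 1762.
Proof.
(* A sum over a range of naturals can be evaluated directly once unlocked. *)
transitivity (\sum_(0 <= a < 31) nth 0 freqs a * odflt 0 (search better_tree (key31 a))).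
  by rewrite big_mkord; apply: eq_bigr => v _; rewrite key31K.
by rewrite unlock; vm_compute.
Qed.

Definition weight31 (a : nat) : N := N.of_nat (nth 0 freqs a).

Lemma output31 : output weight31 31 = N.of_nat 1763.
Proof. by apply/N.eqb_spec; vm_compute. Qed.

Lemma ep_table31 T : hw_table beta31 T -> ep (T 0 31 0) = 1763.
Proof.
have beta_weight (a : 'I_31) : beta31 a = N.to_nat (weight31 a) by rewrite Nat2N.id.
by move=> /(output_encodes beta_weight) ->; rewrite output31 Nat2N.id.
Qed.

Theorem theorem4 :
  [/\ ~ hw_correct,
      (forall c : nat, hw_output beta31 c <-> c = 1763) &
      (exists t : gbst 31, finds_all t /\ cost beta31 t = 1762)].
Proof.
(* Without an actual run, [hw_correct] would hold vacuously on this instance. *)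
have [T hT] := hw_table_exists beta31.
have out1763 : hw_output beta31 1763 by exists T => //; rewrite ep_table31.
split.
- move=> /(_ _ _ _ out1763)[_] /(_ _ better_tree_finds_all).
  by rewrite better_tree_cost.
- by move=> c; split=> [[T' hT' ->]|->//]; apply: ep_table31.
- by exists better_tree; split; [exact: better_tree_finds_all | exact: better_tree_cost].
Qed.
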